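(* Let $\varepsilon>0$, $\alpha=\varepsilon/(2M)$, $\eta=\alpha/(L+\alpha)$, and $z_0\in\mathrm{dom}\, f^*$. Run GCG: for $k\ge0$, $\bar z_k=\mathrm{argmin}_{v\in\mathbb{R}^n}\{\langle-\nabla(h^\alpha)^*(-z_k),v\rangle+f^*(v)\}$ and $z_{k+1}=\eta\bar z_k+(1-\eta)z_k$. Let $\Gamma_k^*(v)=(h^\alpha)^*(-z_k)+\langle-\nabla(h^\alpha)^*(-z_k),v-z_k\rangle+f^*(v)$ be the single-cutting-plane model of the dual problem induced by $z_k$. Then the pair $(z_k,\Gamma_k^* )$ is an $\varepsilon$-certificate, i.e., $\psi^\alpha(z_k)-\min_{v\in\mathbb{R}^n}\Gamma_k^*(v)\le\varepsilon/2$, after $k=\tilde{\mathcal{O}}(1+ML\varepsilon^{-1})$ iterations.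
   Context: Let $\|\cdot\|$ be a norm on $\mathbb{R}^n$ with dual norm $\|\cdot\|_*$. Let $f:\mathbb{R}^n\to\mathbb{R}$ be convex, differentiable and $L$-smooth ($L>0$) with respect to $\|\cdot\|$, $h:\mathbb{R}^n\to(-\infty,\infty]$ closed proper convex with bounded domain, and $w:\mathbb{R}^n\to[0,+\infty]$ closed, $1$-strongly convex with respect to $\|\cdot\|$ on $\mathrm{dom}\, h$, with $M:=\max_{x\in\mathrm{dom}\, h}w(x)<\infty$. Let $h^\alpha=h+\alpha w$ and $\psi^\alpha(z)=(h^\alpha)^*(-z)+f^*(z)$, where $^*$ denotes convex conjugate ($(h^\alpha)^*$ is differentiable with $(1/\alpha)$-Lipschitz gradient, $f^*$ is $(1/L)$-strongly convex w.r.t. $\|\cdot\|_*$). The dual problem is $\min_z\psi^\alpha(z)$, and it is Fenchel dual to $\min_x f(x)+h^\alpha(x)$; a dual $\varepsilon$-certificate (with $\alpha\le\varepsilon/(2M)$) is a pair $(z,\Gamma^* )$ with $\psi^\alpha(z)-\min\Gamma^*\le\varepsilon/2$. The notation $\tilde{\mathcal{O}}$ hides logarithmic factors (in $\varepsilon$ and initial gaps). *)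

(* Defs.v *)
(* R^n is modelled as row vectors 'rV[R]_n
   (with the library's normed/topological structure, used only for
   differentiability and lower semicontinuity; the geometry is given by an
   arbitrary norm [nrm] on R^n). *)
From HB Require Import structures.
From mathcomp Require Import all_boot all_order all_algebra.
From mathcomp Require Import all_classical all_reals all_analysis.
Set Implicit Arguments. Unset Strict Implicit. Unset Printing Implicit Defensive.
Import Order.TTheory GRing.Theory Num.Theory.
Import numFieldNormedType.Exports.
Local Open Scope classical_set_scope.
Local Open Scope ring_scope.

Section Defs.
Variables (R : realType) (n : nat).
Notation V := 'rV[R]_n.

Definition dotp (u v : V) : R := \sum_(i < n) u 0 i * v 0 i.

Definition is_norm (nrm : V -> R) : Prop :=
  [/\ forall x, 0 <= nrm x,
      forall x, nrm x = 0 -> x = 0,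
      forall (a : R) x, nrm (a *: x) = `|a| * nrm x
    & forall x y, nrm (x + y) <= nrm x + nrm y].

Definition dual_norm (nrm : V -> R) (z : V) : R :=
  sup [set dotp z x | x in [set x | nrm x <= 1]].

Definition econj (g : V -> \bar R) (z : V) : \bar R :=
  ereal_sup [set ((dotp z x)%:E - g x)%E | x in [set: V]].

Definition rconj (g : V -> R) (z : V) : \bar R := econj (fun x => (g x)%:E) z.

Definition edom (g : V -> \bar R) : set V := [set x | (g x < +oo)%E].

Definition proper_fun (g : V -> \bar R) : Prop :=
  (exists x, (g x < +oo)%E) /\ (forall x, (-oo < g x)%E).

Definition econvex (g : V -> \bar R) : Prop :=
  forall (x y : V) (t : R), 0 < t < 1 ->
    (g (t *: x + (1 - t) *: y)%R <= t%:E * g x + (1 - t)%:E * g y)%E.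

Definition rconvex (g : V -> R) : Prop :=
  forall (x y : V) (t : R), 0 <= t <= 1 ->
    g (t *: x + (1 - t) *: y) <= t * g x + (1 - t) * g y.

Definition closed_fun (g : V -> \bar R) : Prop := lower_semicontinuous g.

Definition strongly_convex_on (nrm : V -> R) (mu : R) (D : set V)
    (g : V -> \bar R) : Prop :=
  forall (x y : V) (t : R), D x -> D y -> 0 < t < 1 ->
    (g (t *: x + (1 - t) *: y)%R <=
       t%:E * g x + (1 - t)%:E * g y
       - (mu / 2 * t * (1 - t) * (nrm (x - y)) ^+ 2)%:E)%E.

(* gradient: the vector representing the (Frechet) differential *)
Definition grad (g : V -> R) (x : V) : V :=
  \row_(i < n) ('d g x (delta_mx 0 i : V)).

Definition smooth_wrt (nrm : V -> R) (L : R) (g : V -> R) : Prop :=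
  forall x y, dual_norm nrm (grad g x - grad g y) <= L * nrm (x - y).

End Defs.

(* Main.v *)
(** Write [H = h + alpha w].  Strong convexity and compactness give [<u, .> - H] a
    unique maximizer, which is the gradient of [H^*] at [u], and quadratic growth
    around it makes [H^*] (1/alpha)-smooth for the dual norm.  Dually, the
    quadratic upper bound of an L-smooth [f] makes [f^*] (1/L)-strongly convex.
    With [eta = alpha / (L + alpha)] the smoothness error of [H^*] and the strong
    convexity gain of [f^*] along a step cancel exactly, so that
    [psi z_(k+1) <= psi z_k - eta S_k], where [S_k = psi z_k - min Gamma_k].  Since
    [Gamma_k <= psi], [S_k] dominates the optimality gap [delta_k]; hence
    [delta_k <= (1 - eta)^k delta_0] and [S_k <= delta_k / eta]. *)

Require Import Defs.
From HB Require Import structures.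
From mathcomp Require Import all_boot all_order all_algebra.
From mathcomp Require Import all_classical all_reals all_analysis.
From mathcomp Require Import ring lra.
Import Order.TTheory GRing.Theory Num.Theory.
Import numFieldNormedType.Exports.
Local Open Scope classical_set_scope.
Local Open Scope ring_scope.

(** * The coordinate pairing on row vectors *)

Section InnerProduct.
Context {R : realType} {n : nat}.
Local Notation V := 'rV[R]_n.
Implicit Types (u v x y : V) (a : R).

Lemma dotpDl u v x : dotp (u + v) x = dotp u x + dotp v x.
Proof.
by rewrite /dotp -big_split; apply: eq_bigr => i _; rewrite mxE mulrDl.
Qed.

Lemma dotpDr u x y : dotp u (x + y) = dotp u x + dotp u y.
Proof.
by rewrite /dotp -big_split; apply: eq_bigr => i _; rewrite mxE mulrDr.
Qed.

Lemma dotpZl a u x : dotp (a *: u) x = a * dotp u x.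
Proof.
by rewrite /dotp mulr_sumr; apply: eq_bigr => i _; rewrite mxE mulrA.
Qed.

Lemma dotpZr a u x : dotp u (a *: x) = a * dotp u x.
Proof.
by rewrite /dotp mulr_sumr; apply: eq_bigr => i _; rewrite mxE mulrCA.
Qed.

Lemma dotpNl u x : dotp (- u) x = - dotp u x.
Proof. by rewrite -scaleN1r dotpZl mulN1r. Qed.

Lemma dotpNr u x : dotp u (- x) = - dotp u x.
Proof. by rewrite -scaleN1r dotpZr mulN1r. Qed.

Lemma dotpBl u v x : dotp (u - v) x = dotp u x - dotp v x.
Proof. by rewrite dotpDl dotpNl. Qed.

Lemma dotpBr u x y : dotp u (x - y) = dotp u x - dotp u y.
Proof. by rewrite dotpDr dotpNr. Qed.

Lemma dotpC u v : dotp u v = dotp v u.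
Proof. by apply: eq_bigr => i _; rewrite mulrC. Qed.

Lemma dotp0r u : dotp u 0 = 0.
Proof. by rewrite -(scale0r 0) dotpZr mul0r. Qed.

Lemma ler_coord_norm x i : `|x 0 i| <= `|x|.
Proof.
have /mapP[j Hj ->] : `|x ord0 i| \in [seq `|x j.1 j.2| | j : 'I_1 * 'I_n].
  by apply/mapP; exists (ord0, i) => //=; rewrite mem_enum.
by rewrite [leRHS]/Num.norm /= mx_normrE; apply/bigmax_geP; right; exists j.
Qed.

Lemma ler_norm_dotp u v : `|dotp u v| <= n%:R * `|u| * `|v|.
Proof.
apply: le_trans (ler_norm_sum _ _ _) _.
apply: (@le_trans _ _ (\sum_(i < n) `|u| * `|v|)).
  by apply: ler_sum => i _; rewrite normrM ler_pM// ler_coord_norm.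
by rewrite sumr_const card_ord -mulrA mulr_natl.
Qed.

(** Registering [dotp u] as a linear map makes it a candidate differential in [grad_eq]. *)
Fact dotp_is_linear u : linear (dotp u : V -> R^o).
Proof. by move=> a x y; rewrite dotpDr dotpZr. Qed.

HB.instance Definition _ u :=
  GRing.isLinear.Build R V R^o *:%R (dotp u) (dotp_is_linear u).

Lemma lipschitz_rV_continuous (g : V -> R) (K : R) : 0 < K ->
  (forall x y, g x - g y <= K * `|x - y|) -> continuous g.
Proof.
move=> K0 gK x.
have gK' y : `|g x - g y| <= K * `|x - y|.
  by rewrite ler_norml gK andbT lerNl opprB distrC gK.
have FF : Filter (nbhs x) by exact: nbhs_filter.
apply/(@cvgrPdist_le _ _ _ (nbhs x)) => e e0.
near=> y; rewrite (le_trans (gK' _))// -ler_pdivlMl//; near: y.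
by apply: cvgr_dist_le; [exact: cvg_id|rewrite mulrC divr_gt0].
Unshelve. all: by end_near. Qed.

Lemma dotp_continuous u : continuous (dotp u : V -> R).
Proof.
apply: (@lipschitz_rV_continuous _ (n%:R * `|u| + 1)).
  by rewrite ltr_wpDl// mulr_ge0.
move=> x y; rewrite -dotpBr (le_trans (ler_norm _))//.
by rewrite (le_trans (ler_norm_dotp _ _))// ler_wpM2r// lerDl.
Qed.

(** Riesz representation in coordinates: for [l = 'd f x] the row vector is [grad f x]. *)
Lemma linear_dotp (l : {linear V -> R^o}) x :
  l x = dotp (\row_i l (delta_mx 0 i)) x.
Proof.
rewrite [in LHS](row_sum_delta x) linear_sum; apply: eq_bigr => i _.
by rewrite linearZ/= mxE [LHS]mulrC.
Qed.

Lemma row_dotp_delta u : \row_i dotp u (delta_mx 0 i) = u.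
Proof.
apply/rowP => i; rewrite mxE /dotp (bigD1 i)//= mxE !eqxx mulr1.
by rewrite big1 ?addr0// => j ji; rewrite mxE (negbTE ji) andbF mulr0.
Qed.

End InnerProduct.

(** * Equivalence of norms, the dual norm and its quadratic conjugacy *)

Section Norm.
Context {R : realType} {n : nat} {nrm : 'rV[R]_n -> R}.
Hypothesis nrmP : is_norm nrm.
Local Notation V := 'rV[R]_n.
Implicit Types (x y z d : V) (a c : R).

Lemma nrm_ge0 x : 0 <= nrm x. Proof. by case: nrmP. Qed.
Lemma nrm0_eq0 x : nrm x = 0 -> x = 0. Proof. by case: nrmP => _ + _ _; exact. Qed.
Lemma nrmZ a x : nrm (a *: x) = `|a| * nrm x. Proof. by case: nrmP. Qed.
Lemma ler_nrmD x y : nrm (x + y) <= nrm x + nrm y. Proof. by case: nrmP. Qed.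

Lemma nrm0 : nrm 0 = 0.
Proof. by rewrite -(scale0r 0) nrmZ normr0 mul0r. Qed.

Lemma ler_nrm_sum (I : Type) (r : seq I) (F : I -> V) :
  nrm (\sum_(i <- r) F i) <= \sum_(i <- r) nrm (F i).
Proof.
elim/big_ind2 : _ => [|x a y b xa yb|//]; first by rewrite nrm0.
by rewrite (le_trans (ler_nrmD _ _))// lerD.
Qed.

Lemma nrm_le_norm : exists2 A : R, 0 < A & forall x, nrm x <= A * `|x|.
Proof.
(* Expanding [x] in the standard basis gives the sum; the [+ 1] keeps [A] positive when [n = 0]. *)
exists (\sum_(i < n) nrm (delta_mx 0 i) + 1).
  by rewrite ltr_wpDl// sumr_ge0// => i _; exact: nrm_ge0.
move=> x; rewrite {1}(row_sum_delta x) (le_trans (ler_nrm_sum _ _ _))//.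
rewrite mulrDl mul1r -[leLHS]addr0 lerD// mulr_suml ler_sum// => i _.
by rewrite nrmZ mulrC ler_wpM2l ?nrm_ge0 ?ler_coord_norm.
Qed.

Lemma nrm_continuous : continuous nrm.
Proof.
have [A A0 HA] := nrm_le_norm; apply: (@lipschitz_rV_continuous _ _ _ A) => // x y.
by rewrite (le_trans _ (HA _))// lerBlDr -{1}(subrK y x) ler_nrmD.
Qed.

(** On the compact unit sphere of the sup norm the continuous [nrm] has a positive minimum;
    homogeneity does the rest. An empty sphere means that [0] is the only vector. *)
Lemma norm_le_nrm : exists2 K : R, 0 < K & forall x, `|x| <= K * nrm x.
Proof.
pose S : set V := [set x | `|x| = 1].
have [[x0 Sx0]|S0] := pselect (S !=set0); last first.
  exists 1 => // x; have [->|x0] := eqVneq x 0; first by rewrite nrm0 normr0 mulr0.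
  exfalso; apply: S0; exists (`|x|^-1 *: x).
  by rewrite /S /= normrZ normfV normr_id mulVf// normr_eq0.
have cS : compact S.
  apply: bounded_closed_compact.
    by exists 1; split; [exact: num_real|move=> a a1 x /= ->; exact: ltW].
  rewrite (_ : S = (fun x : V => `|x|) @^-1` [set 1])//.
  apply: closed_comp; last exact: closed_eq.
  by move=> x _; exact: norm_continuous.
have [c] : exists2 c, c \in S & forall x, x \in S -> nrm c <= nrm x.
  apply: EVT_min_rV => //; first by exists x0.
  by apply: continuous_subspaceT; exact: nrm_continuous.
rewrite inE => Sc minc.
have c0 : 0 < nrm c.
  rewrite lt_def nrm_ge0 andbT; apply/eqP => /nrm0_eq0 c0.
  by move: Sc; rewrite /S/= c0 normr0 => /eqP; rewrite eq_sym oner_eq0.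
exists (nrm c)^-1; first by rewrite invr_gt0.
move=> x; have [->|xN0] := eqVneq x 0; first by rewrite nrm0 normr0 mulr0.
rewrite ler_pdivlMl// mulrC -ler_pdivlMl ?normr_gt0//.
have := minc (`|x|^-1 *: x); rewrite nrmZ normfV normr_id; apply.
by rewrite inE /S/= normrZ normfV normr_id mulVf// normr_eq0.
Qed.

(** Ensures that the real-valued [sup] in [dual_norm] is a true supremum and not a default value. *)
Lemma dual_ball_has_sup z : has_sup [set dotp z x | x in [set x | nrm x <= 1]].
Proof.
split; first by exists (dotp z 0), 0 => //=; rewrite nrm0.
have [K K0 HK] := norm_le_nrm.
exists (n%:R * `|z| * K) => _ [x /= x1 <-].
rewrite (le_trans (ler_norm _))// (le_trans (ler_norm_dotp _ _))//.
by rewrite ler_wpM2l// ?mulr_ge0// (le_trans (HK x))// ler_piMr// ltW.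
Qed.

Lemma dual_norm_ge0 z : 0 <= dual_norm nrm z.
Proof.
have [_ ub] := dual_ball_has_sup z.
by apply: ub_le_sup => //; exists 0; rewrite /= ?nrm0 ?ler01// dotp0r.
Qed.

Lemma dotp_le_dual z x : dotp z x <= dual_norm nrm z * nrm x.
Proof.
have [->|x0] := eqVneq x 0; first by rewrite dotp0r nrm0 mulr0.
have nx0 : 0 < nrm x.
  by rewrite lt_def nrm_ge0 andbT; apply: contra x0 => /eqP/nrm0_eq0 ->.
rewrite -ler_pdivrMr// mulrC -dotpZr; apply: ub_le_sup.
  by case: (dual_ball_has_sup z).
by exists ((nrm x)^-1 *: x) => //=; rewrite nrmZ gtr0_norm ?invr_gt0// mulVf ?gt_eqF.
Qed.

Lemma dual_norm_le_norm :
  exists2 K : R, 0 < K & forall z, dual_norm nrm z <= K * `|z|.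
Proof.
have [K K0 HK] := norm_le_nrm.
exists (n%:R * K + 1); first by rewrite ltr_wpDl// mulr_ge0// ltW.
move=> z; apply: ge_sup; first by case: (dual_ball_has_sup z).
move=> _ [x /= x1 <-].
rewrite (le_trans (ler_norm _))// (le_trans (ler_norm_dotp _ _))//.
rewrite mulrDl mul1r -[leLHS]addr0 lerD// mulrAC ler_wpM2r// ler_wpM2l//.
by rewrite (le_trans (HK x))// ler_piMr// ltW.
Qed.

(** Young's inequality: after [dotp_le_dual], the difference of the two sides is a square. *)
Lemma dotp_le_squares c z x : 0 < c ->
  dotp z x <= dual_norm nrm z ^+ 2 / (2 * c) + c / 2 * nrm x ^+ 2.
Proof.
move=> c0; apply: le_trans (dotp_le_dual z x) _.
set s := dual_norm _ _; set r := nrm x.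
have -> : s ^+ 2 / (2 * c) + c / 2 * r ^+ 2 = s * r + (s - c * r) ^+ 2 / (2 * c).
  by field; rewrite ?gt_eqF.
by rewrite lerDl divr_ge0 ?sqr_ge0 ?mulr_ge0 ?ltW.
Qed.

(* The conjugate of [c/2 nrm^2] is [1/(2c) dual_norm^2]; this is the half that
   needs near-optimal points. *)
Lemma dual_norm_square_le c z b : 0 < c ->
  (forall d, dotp z d - c / 2 * nrm d ^+ 2 <= b) ->
  dual_norm nrm z ^+ 2 / (2 * c) <= b.
Proof.
move=> c0 Hb; set s := dual_norm nrm z.
have [s0|sN0] := eqVneq s 0.
  by have := Hb 0; rewrite dotp0r nrm0 s0 expr0n/= mulr0 mul0r subr0.
have s0 : 0 < s by rewrite lt_def sN0 dual_norm_ge0.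
(* The goal is equivalent to an upper bound on [s], hence to a bound on each element of the set
   whose supremum is [s]. Each one follows by testing [d = (s / c) *: x], the optimal length. *)
suff : s <= (b + s ^+ 2 / (2 * c)) * (c / s).
  rewrite -ler_pdivrMr ?divr_gt0//.
  have -> : s / (c / s) = s ^+ 2 / (2 * c) + s ^+ 2 / (2 * c).
    by field; rewrite ?gt_eqF.
  by rewrite lerD2r.
apply: ge_sup; first by case: (dual_ball_has_sup z).
move=> _ [x /= x1 <-]; rewrite -ler_pdivrMr ?divr_gt0//.
have := Hb ((s / c) *: x); rewrite dotpZr nrmZ lerBlDr gtr0_norm ?divr_gt0//.
rewrite invf_div mulrC => /le_trans; apply; rewrite lerD2l.
have -> : c / 2 * (s / c * nrm x) ^+ 2 = s ^+ 2 / (2 * c) * nrm x ^+ 2.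
  by field; rewrite ?gt_eqF.
rewrite ler_piMr ?exprn_ile1 ?nrm_ge0//.
by rewrite divr_ge0 ?sqr_ge0// mulr_ge0// ltW.
Qed.

End Norm.

(** * Strong convexity of the conjugate of a smooth function *)

Section SmoothConjugate.
Context {R : realType} {n : nat} {nrm : 'rV[R]_n -> R} {f : 'rV[R]_n -> R} {L : R}.
Hypothesis nrmP : is_norm nrm.
Hypothesis f_diff : forall x, differentiable f x.
Hypothesis f_smooth : smooth_wrt nrm L f.
Local Notation V := 'rV[R]_n.
Implicit Types (x d z : V) (t : R).

Lemma is_derive_line x d t :
  is_derive t (1 : R) (fun s => f (x + s *: d)) (dotp (grad f (x + t *: d)) d).
Proof.
set a := x + t *: d.
have line : (fun h : R => h^-1 *: (((fun s => f (x + s *: d)) \o shift t) (h *: 1)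
      - f a)) = (fun h => h^-1 *: ((f \o shift a) (h *: d) - f a)).
  apply/funext => h /=; congr (_ *: (f _ - _)).
  by rewrite /a [h *: 1]mulr1 scalerDl addrCA.
have df : derivable f a d by exact/diff_derivable.
split; first by rewrite /derivable line.
rewrite /derive line -/(derive f a d) deriveE//.
by rewrite [LHS](linear_dotp ('d f a)).
Qed.

Lemma smooth_upper_bound x d :
  f (x + d) <= f x + dotp (grad f x) d + L / 2 * nrm d ^+ 2.
Proof.
set g0 := dotp (grad f x) d; set q := L / 2 * nrm d ^+ 2.
(* The claim reads [phi 1 <= phi 0]. By the mean value theorem it is enough that [dphi] is
   nonpositive at the intermediate point, which the Lipschitz gradient gives without any
   integration. *)
pose phi s := f (x + s *: d) - (s * g0 + s ^+ 2 * q).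
pose dphi s := dotp (grad f (x + s *: d)) d - (g0 + 2 * s * q).
have dphiP s : is_derive s (1 : R) phi (dphi s).
  have H1 := is_derive_line x d s.
  have H2 : is_derive s (1 : R) (fun s => s * g0 + s ^+ 2 * q) (g0 + 2 * s * q).
    apply: is_derive_eq.
    by rewrite /GRing.scale/=; ring.
  exact: is_deriveB.
have phi_cont : {within `[0, 1], continuous phi}.
  by apply: derivable_within_continuous => s _; have [] := dphiP s.
have [c] := MVT_segment ler01 (fun s _ => dphiP s) phi_cont.
rewrite in_itv/= => /andP[c0 _].
rewrite subr0 mulr1 /phi scale1r scale0r addr0 !mul0r mul1r expr1n mul1r expr0n/=.
rewrite mul0r addr0 subr0 => E.
suff : dphi c <= 0 by rewrite -E; lra.
rewrite /dphi opprD addrA -dotpBl subr_le0.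
apply: le_trans (dotp_le_dual nrmP _ _) _.
have := f_smooth (x + c *: d) x; rewrite [x + _ - x]addrC addKr.
rewrite (nrmZ nrmP) (ger0_norm c0) => H.
apply: (le_trans (ler_wpM2r (nrm_ge0 nrmP d) H)).
by rewrite /q le_eqVlt; apply/orP; left; apply/eqP; field.
Qed.

Lemma rconj_ge z x : ((dotp z x - f x)%:E <= rconj f z)%E.
Proof. by apply: ereal_sup_ubound; exists x. Qed.

(** For fixed [x], Fenchel's inequality is used for [z1] at [x + (1 - t) d] and for [z2] at
    [x - t d]. These points average to [x], so the gradient terms of the smoothness bounds cancel
    and the quadratic ones add up to [t (1 - t) L / 2 * nrm d ^+ 2]; optimizing over [d] produces
    the dual norm. *)
Lemma rconj_strongly_convex (z1 z2 : V) (a1 a2 t : R) : 0 < L ->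
  rconj f z1 = a1%:E -> rconj f z2 = a2%:E -> 0 < t < 1 ->
  (rconj f (t *: z1 + (1 - t) *: z2) <=
   (t * a1 + (1 - t) * a2
    - t * (1 - t) * (dual_norm nrm (z1 - z2) ^+ 2 / (2 * L)))%:E)%E.
Proof.
move=> L0 e1 e2 /andP[t0 t1]; apply: ge_ereal_sup => _ [x _ <-].
have tt0 : 0 < t * (1 - t) by rewrite mulr_gt0 ?subr_gt0.
rewrite -EFinB lee_fin dotpDl !dotpZl.
suff : dual_norm nrm (z1 - z2) ^+ 2 / (2 * L) <=
    (t * a1 + (1 - t) * a2 - (t * dotp z1 x + (1 - t) * dotp z2 x) + f x)
    / (t * (1 - t)).
  by rewrite ler_pdivlMr//; lra.
apply: (dual_norm_square_le nrmP) => // d; rewrite ler_pdivlMr//.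
have := rconj_ge z1 (x + (1 - t) *: d).
have := rconj_ge z2 (x + (- t) *: d).
rewrite e1 e2 !lee_fin !dotpDr !dotpZr dotpBl.
have := smooth_upper_bound x ((1 - t) *: d).
have := smooth_upper_bound x ((- t) *: d).
have t1' : 0 <= 1 - t by rewrite subr_ge0 ltW.
rewrite !dotpZr !(nrmZ nrmP) normrN (gtr0_norm t0) (ger0_norm t1').
set g := dotp (grad f x) d; set N := nrm d; set p := dotp z1 d; set r := dotp z2 d.
set F1 := f (x + (1 - t) *: d); set F2 := f (x + (- t) *: d) => h2 h1 k2 k1.
have := ler_wpM2l (ltW t0) h1; have := ler_wpM2l (ltW t0) k1.
have := ler_wpM2l t1' h2; have := ler_wpM2l t1' k2.
lra.
Qed.

End SmoothConjugate.

(** * Lower semicontinuity and minimizers on compact sets *)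

Lemma lte_fin_between {R : realFieldType} {a b : \bar R} :
  (a < b)%E -> exists r : R, (a < r%:E < b)%E.
Proof.
case: a b => [a| |] [b| |]//= ab.
- by exists ((a + b) / 2); rewrite !lte_fin !midf_lt.
- by exists (a + 1); rewrite lte_fin ltrDl ltr01 ltry.
- by exists (b - 1); rewrite lte_fin gtrBl ltr01 ltNyr.
- by exists 0; rewrite ltNyr ltry.
Qed.

Section LowerSemicontinuity.
Context {R : realType} {T : topologicalType}.
Implicit Types f g : T -> \bar R.

Lemma lower_semicontinuousD f g :
  (forall x, -oo < f x)%E -> (forall x, -oo < g x)%E ->
  lower_semicontinuous f -> lower_semicontinuous g ->
  lower_semicontinuous (fun x => f x + g x)%E.
Proof.
move=> f0 g0 fl gl x a afg.
(* The level [a] is split between the two summands; if [g x = +oo], any real [b] below [f x] will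
   do. *)
have [b bf bg] : exists2 b : R, (b%:E < f x)%E & ((a - b)%:E < g x)%E.
  move: (g0 x) afg; case gx: (g x) => [r| |]// _ afg.
    have : (a%:E - r%:E < f x)%E by rewrite lteBlDr.
    move=> /lte_fin_between[b /andP[ab bf]]; exists b => //.
    by move: ab; rewrite -EFinB !lte_fin ltrBlDl ltrBlDr.
  have [b /andP[_ bf]] := lte_fin_between (f0 x).
  by exists b => //; rewrite ltry.
have [U xU fU] := fl x b bf; have [W xW gW] := gl x (a - b) bg.
exists (U `&` W); first exact: filterI.
move=> y [/fU fy /gW gy]; have := lteD fy gy.
by rewrite -EFinD addrC subrK.
Qed.

Lemma lower_semicontinuousZ (c : R) f : 0 < c ->
  lower_semicontinuous f -> lower_semicontinuous (fun x => c%:E * f x)%E.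
Proof.
move=> c0 fl x a; rewrite -lte_pdivrMl// -EFinM => /fl[U xU fU].
by exists U => // y /fU; rewrite EFinM lte_pdivrMl.
Qed.

Lemma continuous_lower_semicontinuous (g : T -> R) :
  continuous g -> lower_semicontinuous (fun x => (g x)%:E).
Proof.
move=> gc; apply/lower_semicontinuousP => a.
rewrite (_ : [set _ | _] = g @^-1` [set r | a < r]).
  by apply: open_comp => [x _|]; [exact: gc|exact: open_gt].
by apply/seteqP; split => x /=; rewrite lte_fin.
Qed.

(* A cluster point of the sublevel sets meeting [K] is a minimizer. *)
Lemma compact_lower_semicontinuous_min f (K : set T) :
  compact K -> K !=set0 -> lower_semicontinuous f ->
  exists2 x, K x & forall y, K y -> (f x <= f y)%E.
Proof.
move=> cK [x0 Kx0] fl.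
pose D := [set a : R | exists2 y, K y & (f y < a%:E)%E].
(* If [D] is empty, [f] is [+oo] on all of [K] and any point is a minimizer. *)
have [[a0 Da0]|ND] := pselect (exists a, D a); last first.
  exists x0 => // y Ky; rewrite leNgt; apply/negP.
  move=> /lte_fin_between[a /andP[ya _]].
  by apply: ND; exists a, y.
pose B (a : R) := K `&` [set y | (f y < a%:E)%E].
have FF : ProperFilter (filter_from D B).
  apply: filter_from_proper; last by move=> a [y Ky fya]; exists y.
  apply: filter_from_filter; first by exists a0.
  move=> i j Di Dj; exists (Num.min i j).
    by rewrite /Order.min; case: ifP.
  by move=> y [Ky] /=; rewrite EFin_min lt_min => /andP[].
have FK : filter_from D B K by exists a0 => // y [].
have [p [Kp clp]] := cK _ FF FK.
exists p => // y Ky; rewrite leNgt; apply/negP => /lte_fin_between[a /andP[ya ap]].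
have [U pU fU] := fl p a ap.
have FBa : filter_from D B (B a) by exists a => //; exists y.
have [q [[_ /= qa] /fU aq]] := clp _ _ FBa pU.
by have := lt_trans qa aq; rewrite ltxx.
Qed.

End LowerSemicontinuity.

(** * Smoothness of the conjugate of a strongly convex function *)

Lemma grad_eq {R : realType} {n : nat} (g : 'rV[R]_n -> R) (u p : 'rV[R]_n) (C : R) :
  0 < C -> (forall v, `|g v - g u - dotp p (v - u)| <= C * `|v - u| ^+ 2) ->
  grad g u = p.
Proof.
move=> C0 gC; rewrite /grad.
suff -> : 'd g u = dotp p :> ('rV[R]_n -> R^o) by exact: row_dotp_delta.
apply: (@diff_unique R 'rV[R]_n R^o g (dotp p) u); first exact: dotp_continuous.
(* The quadratic remainder is at most [e] times the norm of [d] once that norm is below [e / C]. *)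
apply/eqaddoP => e e0; near=> d.
have := gC (d + u); rewrite addrK => H.
rewrite -[(g \o shift u - _) d]/(g (d + u) - (g u + dotp p d)) opprD addrA.
apply: (le_trans H); rewrite expr2 mulrA ler_wpM2r// -ler_pdivlMl//.
near: d; apply: cvgr0_norm_le; first exact: cvg_id.
by rewrite mulrC divr_gt0.
Unshelve. all: by end_near. Qed.

(** A real-valued form, since [grad] takes real functions; [econj_fineK] shows that [fine] loses
    nothing here. *)
Definition fconj {R : realType} {n : nat} (H : 'rV[R]_n -> \bar R) (u : 'rV[R]_n) : R :=
  fine (econj H u).

Section StronglyConvexConjugate.
Context {R : realType} {n : nat} {nrm : 'rV[R]_n -> R} {H : 'rV[R]_n -> \bar R}.
Context {alpha : R}.
Hypothesis nrmP : is_norm nrm.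
Hypothesis alpha_gt0 : 0 < alpha.
Hypothesis H_closed : closed_fun H.
Hypothesis H_proper : proper_fun H.
Hypothesis H_bounded : exists B : R, forall x, edom H x -> nrm x <= B.
Hypothesis H_sc : strongly_convex_on nrm alpha (edom H) H.
Local Notation V := 'rV[R]_n.
Implicit Types (u v x y : V).
Local Notation Hr := (fine \o H).
Local Notation Hs := (fconj H).

Lemma edom_fineK x : edom H x -> H x = (Hr x)%:E.
Proof. by move=> Hx; rewrite /= fineK// fin_numElt Hx H_proper.2. Qed.

Lemma tilted_minimizer u :
  exists2 x, edom H x & forall y, edom H y -> Hr x - dotp u x <= Hr y - dotp u y.
Proof.
have [B HB] := H_bounded; have [K K0 nK] := norm_le_nrm nrmP.
have [[x0 Hx0] H_gt] := H_proper.
(* The domain may fail to be closed, so the minimum is taken over a closed ball containing it;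
   finiteness at [x0] puts the minimizer back in the domain. *)
pose S : set V := [set x | `|x| <= K * B].
have domS x : edom H x -> S x.
  by move=> /HB xB; rewrite /S/= (le_trans (nK x))// ler_pM2l.
have cS : compact S.
  apply: bounded_closed_compact.
    exists (K * B); split; first exact: num_real.
    by move=> a Ka x /= xS; apply: (le_trans xS); exact: ltW.
  rewrite (_ : S = (fun x : V => `|x|) @^-1` [set r | r <= K * B])//.
  apply: closed_comp; last exact: closed_le.
  by move=> x _; exact: norm_continuous.
have G_lsc : lower_semicontinuous (fun x => H x + (dotp (- u) x)%:E)%E.
  apply: lower_semicontinuousD => //; first by move=> x; exact: ltNyr.
  by apply: continuous_lower_semicontinuous; exact: dotp_continuous.
have [x Sx xmin] := compact_lower_semicontinuous_min
  (fun x => H x + (dotp (- u) x)%:E)%E S cS (ex_intro _ x0 (domS _ Hx0)) G_lsc.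
have Hx : edom H x.
  have := xmin _ (domS _ Hx0).
  rewrite (edom_fineK x0 Hx0) -EFinD /edom/=.
  by case: (H x) => //= r; rewrite ltry.
exists x => // y Hy; have := xmin _ (domS _ Hy).
by rewrite (edom_fineK x Hx) (edom_fineK y Hy) -!EFinD lee_fin !dotpNl.
Qed.

(** Comparing [x] with [t *: y + (1 - t) *: x] and dividing by [t] gives [(1 - t) * c <= D]; then
    [t] tends to [0]. *)
Lemma tilted_minimizer_growth u x y : edom H x -> edom H y ->
  (forall y', edom H y' -> Hr x - dotp u x <= Hr y' - dotp u y') ->
  Hr x - dotp u x + alpha / 2 * nrm (y - x) ^+ 2 <= Hr y - dotp u y.
Proof.
move=> Hx Hy xmin; set c := alpha / 2 * _ ^+ 2.
have c0 : 0 <= c by rewrite mulr_ge0 ?sqr_ge0// divr_ge0// ltW.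
pose D := Hr y - dotp u y - (Hr x - dotp u x).
have Dt t : 0 < t < 1 -> (1 - t) * c <= D.
  move=> t01; have /andP[t0 t1] := t01.
  set z := t *: y + (1 - t) *: x.
  have := H_sc y x t Hy Hx t01; rewrite -/z (edom_fineK x Hx) (edom_fineK y Hy).
  rewrite -!EFinM -EFinN -!EFinD => Hz.
  have dz : edom H z by rewrite /edom/= (le_lt_trans Hz)// ltry.
  move: Hz; rewrite (edom_fineK z dz) lee_fin => Hz.
  have := xmin z dz; rewrite {2}/z dotpDr !dotpZr => Hxz.
  rewrite -(ler_pM2l t0) /D /c; lra.
suff : c <= D by rewrite /D; lra.
rewrite leNgt; apply/negP => Dc.
have D0 : 0 <= D.
  have /Dt : (0 < (1 / 2 : R) < 1) by apply/andP; split; lra.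
  lra.
have cp : 0 < c by exact: le_lt_trans Dc.
(* In place of a limit, this [t] makes the left side the midpoint of [c] and [D], which exceeds [D]
   if [D < c]. *)
have : (1 - (c - D) / (2 * c)) * c <= D.
  have c2 : 0 < 2 * c by rewrite mulr_gt0.
  by apply: Dt; rewrite ltr_pdivlMr// ltr_pdivrMr//; apply/andP; split; lra.
have -> : (1 - (c - D) / (2 * c)) * c = (c + D) / 2 by field; rewrite gt_eqF.
lra.
Qed.

Lemma econj_at_minimizer u x : edom H x ->
  (forall y, edom H y -> Hr x - dotp u x <= Hr y - dotp u y) ->
  econj H u = (dotp u x - Hr x)%:E.
Proof.
move=> Hx xmin; apply/eqP; rewrite eq_le; apply/andP; split.
  apply: ge_ereal_sup => _ [y _ <-].
  have [Hy|Hy] := pselect (edom H y).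
    by rewrite (edom_fineK y Hy) -EFinB lee_fin; have := xmin y Hy; lra.
  suff -> : H y = +oo%E by rewrite leNye.
  by apply/eqP; rewrite -leye_eq leNgt; apply/negP.
by apply: ereal_sup_ubound; exists x => //; rewrite (edom_fineK x Hx) -EFinB.
Qed.

Lemma econj_fineK u : econj H u = (Hs u)%:E.
Proof.
have [x Hx xmin] := tilted_minimizer u.
by rewrite /fconj (econj_at_minimizer u x Hx xmin).
Qed.

(** The slope [p] is the maximizer [x] at [u]. The lower bound uses [x] as a competitor at [v]; in
    the upper one, quadratic growth at [x] absorbs [dotp (v - u) (y - x)] by Young's inequality. *)
Lemma econj_first_order_bounds u :
  exists p, forall v, Hs u + dotp p (v - u) <= Hs v
    <= Hs u + dotp p (v - u) + dual_norm nrm (v - u) ^+ 2 / (2 * alpha).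
Proof.
have [x Hx xmin] := tilted_minimizer u; exists x => v.
have [y Hy ymin] := tilted_minimizer v.
have -> : Hs u = dotp u x - Hr x by rewrite /fconj (econj_at_minimizer u x Hx xmin).
have -> : Hs v = dotp v y - Hr y by rewrite /fconj (econj_at_minimizer v y Hy ymin).
have := ymin x Hx; have := tilted_minimizer_growth u x y Hx Hy xmin.
have := dotp_le_squares nrmP alpha (v - u) (y - x) alpha_gt0.
rewrite (dotpC x) !dotpBl !dotpBr.
by move=> *; apply/andP; split; lra.
Qed.

(** The two bounds squeeze the first-order remainder. Passing to the sup norm, in which
    differentiability is defined, [grad_eq] identifies [p] with the gradient. *)
Lemma econj_grad_bounds u v :
  Hs u + dotp (grad Hs u) (v - u) <= Hs v
    <= Hs u + dotp (grad Hs u) (v - u) + dual_norm nrm (v - u) ^+ 2 / (2 * alpha).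
Proof.
have [p Hp] := econj_first_order_bounds u.
suff -> : grad Hs u = p by exact: Hp.
have [K K0 nK] := dual_norm_le_norm nrmP.
apply: (@grad_eq _ _ _ _ _ (K ^+ 2 / (2 * alpha))).
  by rewrite divr_gt0 ?mulr_gt0 ?exprn_gt0.
move=> v'; have /andP[lo up] := Hp v'.
rewrite ger0_norm; last by lra.
apply: (@le_trans _ _ (dual_norm nrm (v' - u) ^+ 2 / (2 * alpha))); first by lra.
rewrite [leRHS]mulrAC ler_pM2r ?invr_gt0 ?mulr_gt0// -exprMn.
by rewrite lerXn2r ?nnegrE ?dual_norm_ge0 ?mulr_ge0 ?(ltW K0).
Qed.

End StronglyConvexConjugate.

Lemma dual_normZ_le {R : realType} {n : nat} {nrm : 'rV[R]_n -> R}
    (nrmP : is_norm nrm) (a : R) (z : 'rV[R]_n) :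
  0 <= a -> dual_norm nrm (a *: z) <= a * dual_norm nrm z.
Proof.
move=> a0; apply: ge_sup; first by case: (dual_ball_has_sup nrmP (a *: z)).
move=> _ [x /= x1 <-]; rewrite dotpZl ler_wpM2l//.
apply: le_trans (dotp_le_dual nrmP z x) _.
by rewrite ler_piMr// dual_norm_ge0.
Qed.

(** * Properties of [h + alpha w] inherited from [h] and [w] *)

Definition regularized {R : realType} {n : nat} (h w : 'rV[R]_n -> \bar R) (alpha : R) :=
  fun x => (h x + alpha%:E * w x)%E.

Section Regularization.
Context {R : realType} {n : nat} {nrm : 'rV[R]_n -> R} {h w : 'rV[R]_n -> \bar R}.
Context {M alpha : R}.
Hypothesis h_closed : closed_fun h.
Hypothesis h_proper : proper_fun h.
Hypothesis h_convex : econvex h.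
Hypothesis w_ge0 : forall x, (0 <= w x)%E.
Hypothesis w_closed : closed_fun w.
Hypothesis w_sc : strongly_convex_on nrm 1 (edom h) w.
Hypothesis w_le : forall x, edom h x -> (w x <= M%:E)%E.
Hypothesis alpha_gt0 : 0 < alpha.
Local Notation H := (regularized h w alpha).

Lemma scaled_regularizer_ge0 x : (0 <= alpha%:E * w x)%E.
Proof. by rewrite mule_ge0// lee_fin ltW. Qed.

Lemma regularized_edom : edom H = edom h.
Proof.
apply/seteqP; split => x; rewrite /edom /regularized /=.
  by apply: le_lt_trans; rewrite leeDl// scaled_regularizer_ge0.
move=> hx; rewrite lte_add_pinfty// lte_mul_pinfty// ?lee_fin ?ltW//.
by rewrite (le_lt_trans (w_le x hx))// ltry.
Qed.

Lemma regularized_proper : proper_fun H.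
Proof.
have [[x hx] h_gt] := h_proper; split.
  by exists x; have : edom H x by rewrite regularized_edom.
move=> y; apply: lt_le_trans (h_gt y) _.
by rewrite leeDl// scaled_regularizer_ge0.
Qed.

Lemma regularized_closed : closed_fun H.
Proof.
apply: lower_semicontinuousD => //; first exact: h_proper.2.
  by move=> x; rewrite (lt_le_trans (ltNyr 0))// scaled_regularizer_ge0.
exact: lower_semicontinuousZ.
Qed.

Lemma regularized_strongly_convex : strongly_convex_on nrm alpha (edom H) H.
Proof.
rewrite regularized_edom => x y t hx hy t01.
have h_fin v : edom h v -> h v = (fine (h v))%:E.
  by move=> hv; rewrite fineK// fin_numElt hv h_proper.2.
have w_fin v : edom h v -> w v = (fine (w v))%:E.
  move=> hv; rewrite fineK// fin_numElt (lt_le_trans (ltNyr 0) (w_ge0 v)).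
  by rewrite (le_lt_trans (w_le v hv))// ltry.
have := h_convex x y t t01; have := w_sc x y t hx hy t01; rewrite /regularized.
set v := t *: x + (1 - t) *: y.
rewrite (h_fin x)// (h_fin y)// (w_fin x)// (w_fin y)//.
rewrite -!EFinM -!EFinN -!EFinD => wv hv.
have dv : edom h v by rewrite /edom/= (le_lt_trans hv)// ltry.
move: wv hv; rewrite (h_fin v)// (w_fin v)// -EFinM -EFinD !lee_fin => wv hv.
have := ler_wpM2l (ltW alpha_gt0) wv; lra.
Qed.

End Regularization.

(** * Convergence rate and iteration count *)

Lemma gap_geometric_decay {R : realType} (eta : R) (delta S : nat -> R) :
  0 < eta <= 1 -> (forall k, 0 <= delta k <= S k) ->
  (forall k, delta k.+1 <= delta k - eta * S k) ->
  forall k, S k <= (1 - eta) ^+ k * delta 0%N / eta.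
Proof.
move=> /andP[eta0 eta1] dS step.
have decay k : delta k <= (1 - eta) ^+ k * delta 0%N.
  elim: k => [|k IH]; first by rewrite expr0 mul1r.
  rewrite exprS -mulrA; apply: (@le_trans _ _ ((1 - eta) * delta k)); last first.
    by rewrite ler_wpM2l// subr_ge0.
  have /andP[_ dSk] := dS k; have := ler_wpM2l (ltW eta0) dSk; have := step k.
  lra.
(* Since [delta k.+1] is nonnegative, the step inequality also yields [eta * S k <= delta k]. *)
move=> k; rewrite ler_pdivlMr//; apply: le_trans (decay k).
have /andP[d0 _] := dS k.+1; have := step k; lra.
Qed.

(** With [A], [B] the arguments of the logarithms and [T] the last factor, [1 / eta = 2 A - 1], so
    [k >= 4 A T] forces [eta * k >= 2 T]. Then [(1 - eta) ^+ k <= exp (- 2 T) <= 1 / (4 A B)], while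
    [D0 / eta <= 2 A B eps]. *)
Lemma iteration_bound {R : realType} (L M eps D0 : R) (k : nat) :
  0 < L -> 0 < M -> 0 < eps -> 0 <= D0 ->
  let alpha := eps / (2 * M) in
  let eta := alpha / (L + alpha) in
  4 * (1 + M * L / eps) * (1 + ln (1 + M * L / eps) + ln (1 + D0 / eps)) <= k%:R ->
  (1 - eta) ^+ k * D0 / eta <= eps / 2.
Proof.
move=> L0 M0 e0 D00 alpha eta.
set A := 1 + M * L / eps; set B := 1 + D0 / eps => hk.
have A1 : 1 <= A by rewrite lerDl ltW// divr_gt0// mulr_gt0.
have B1 : 1 <= B by rewrite lerDl divr_ge0// ltW.
have A0 : 0 < A by exact: lt_le_trans A1.
have B0 : 0 < B by exact: lt_le_trans B1.
have alpha0 : 0 < alpha by rewrite divr_gt0 ?mulr_gt0.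
have eta0 : 0 < eta by rewrite divr_gt0 ?addr_gt0.
have eta1 : eta <= 1 by rewrite ler_pdivrMr ?addr_gt0// mul1r lerDr ltW.
have etaV : eta^-1 = 2 * A - 1.
  rewrite /eta /alpha /A; field.
  by rewrite ?gt_eqF ?addr_gt0 ?mulr_gt0.
set T := 1 + ln A + ln B in hk.
have T0 : 0 <= T by rewrite !addr_ge0 ?ln_ge0.
have etak : 2 * T <= eta * k%:R.
  rewrite -ler_pdivrMl// etaV; apply: le_trans hk.
  by have := mulr_ge0 (ltW A0) T0; lra.
have pow : (1 - eta) ^+ k <= expR (- (2 * T)).
  apply: (@le_trans _ _ (expR (- eta) ^+ k)).
    by rewrite lerXn2r ?nnegrE ?expR_ge0 ?subr_ge0// expR_ge1Dx.
  by rewrite -expRM_natr mulNr ler_expR lerN2.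
(* Here [expR T] is [e A B]; squaring, with [e >= 2] and [A B >= 1], leaves room for the factor
   [4]. *)
have eT : 4 * (A * B) <= expR (2 * T).
  have -> : expR (2 * T) = expR T ^+ 2 by rewrite mulrC expRM_natr.
  have -> : expR T = expR 1 * (A * B) by rewrite !expRD !lnK ?posrE// mulrA.
  have e2 : 2 <= expR 1 :> R by have := expR_ge1Dx (1 : R); lra.
  have AB1 : 1 <= A * B by rewrite -[1]mulr1 ler_pM.
  have q : 2 * (A * B) <= expR 1 * (A * B) by rewrite ler_wpM2r// (le_trans _ AB1).
  nra.
rewrite etaV.
have D0B : D0 <= eps * B by rewrite /B mulrDr mulr1 mulrC divfK ?gt_eqF// lerDr ltW.
apply: (@le_trans _ _ (expR (- (2 * T)) * (eps * B) * (2 * A))).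
  by rewrite ler_pM ?ler_pM ?mulr_ge0 ?exprn_ge0 ?subr_ge0//; lra.
rewrite expRN -mulrA mulrC ler_pdivrMr ?expR_gt0//.
have := ler_wpM2l (ltW e0) eT; lra.
Qed.

(** * One GCG step as descent on the dual objective *)

Theorem theorem3p3 (R : realType) :
  exists C : R, 0 < C /\
  forall (n : nat) (nrm : 'rV[R]_n -> R) (f : 'rV[R]_n -> R)
         (h w : 'rV[R]_n -> \bar R) (L M eps : R),
    is_norm nrm ->
    (* f convex, differentiable, L-smooth *)
    rconvex f -> (forall x, differentiable f x) -> 0 < L ->
    smooth_wrt nrm L f ->
    (* h closed proper convex with bounded domain *)
    closed_fun h -> proper_fun h -> econvex h ->
    (exists B : R, forall x, edom h x -> nrm x <= B) ->
    (* w : R^n -> [0,+oo] closed, 1-strongly convex on dom h *)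
    (forall x, (0 <= w x)%E) -> closed_fun w ->
    strongly_convex_on nrm 1 (edom h) w ->
    (* M = max_{x in dom h} w x *)
    (forall x, edom h x -> (w x <= M%:E)%E) ->
    (exists x, edom h x /\ w x = M%:E) ->
    0 < M ->
    0 < eps ->
    let alpha := eps / (2 * M) in
    let eta := alpha / (L + alpha) in
    let halpha := fun x => (h x + alpha%:E * w x)%E in
    let hstar := fun u => fine (econj halpha u) in
    let fstar := rconj f in
    let psi := fun z => (econj halpha (- z) + fstar z)%E in
    forall (z zbar : nat -> 'rV[R]_n) (D0 : R),
      (* z_0 in dom f^* *)
      (fstar (z 0%N) < +oo)%E ->
      (* D0 = initial dual optimality gap psi^alpha(z_0) - inf psi^alpha *)
      (psi (z 0%N) - ereal_inf (range psi))%E = D0%:E ->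
      (* GCG iteration *)
      (forall k v,
         ((dotp (- grad hstar (- z k)) (zbar k))%:E + fstar (zbar k)
            <= (dotp (- grad hstar (- z k)) v)%:E + fstar v)%E) ->
      (forall k, z k.+1 = eta *: zbar k + (1 - eta) *: z k) ->
      let Gamma := fun k v =>
        (econj halpha (- z k)
           + (dotp (- grad hstar (- z k)) (v - z k))%:E + fstar v)%E in
      forall k : nat,
        C * (1 + M * L / eps)
          * (1 + ln (1 + M * L / eps) + ln (1 + D0 / eps)) <= k%:R ->
        (psi (z k) - ereal_inf (range (Gamma k)) <= (eps / 2)%:E)%E.
Proof.
exists 4; split => // n nrm f h w L M eps nrmP f_conv f_diff L0 f_smooth.
move=> h_closed h_proper h_convex h_bnd w_ge0 w_closed w_sc w_le _ M0 e0.
move=> alpha eta halpha hstar fstar psi z zbar D0 fz0 D0E zbarP zS Gamma k hk.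
have alpha0 : 0 < alpha by rewrite divr_gt0 ?mulr_gt0.
have La0 : 0 < L + alpha by rewrite addr_gt0.
have eta0 : 0 < eta by rewrite divr_gt0.
have eta1 : eta < 1 by rewrite ltr_pdivrMr// mul1r ltrDr.
have H_proper : proper_fun halpha by exact: regularized_proper w_le alpha0.
have H_closed : closed_fun halpha by exact: regularized_closed.
have H_sc : strongly_convex_on nrm alpha (edom halpha) halpha.
  exact: regularized_strongly_convex w_le alpha0.
have H_bnd : exists B : R, forall x, edom halpha x -> nrm x <= B.
  by rewrite (regularized_edom w_ge0 w_le alpha0).
have hs_fin u : econj halpha u = (hstar u)%:E.
  exact: econj_fineK nrmP H_closed H_proper H_bnd u.
have hs_bounds u v : hstar u + dotp (grad hstar u) (v - u) <= hstar v
    <= hstar u + dotp (grad hstar u) (v - u) + dual_norm nrm (v - u) ^+ 2 / (2 * alpha).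
  exact: (econj_grad_bounds nrmP alpha0 H_closed H_proper H_bnd H_sc).
have fs_gt v : (-oo < fstar v)%E.
  exact: lt_le_trans (ltNyr _) (rconj_ge v 0).
pose F v := fine (fstar v).
have F_fin v : (fstar v < +oo)%E -> fstar v = (F v)%:E.
  by move=> fv; rewrite /F fineK// fin_numElt fs_gt fv.
(* Optimality of [zbar i] against [z 0], where [fstar] is finite, makes [fstar (zbar i)] finite. *)
have Fzbar i : fstar (zbar i) = (F (zbar i))%:E.
  apply: (F_fin _); have := zbarP i (z 0%N).
  by rewrite (F_fin _ fz0); case: (fstar _) => //= r _; exact: ltry.
have fs_step i : fstar (z i) = (F (z i))%:E ->
    (fstar (z i.+1) <= ((1 - eta) * F (z i) + (1 - (1 - eta)) * F (zbar i) -
      (1 - eta) * (1 - (1 - eta)) *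
      (dual_norm nrm (z i - zbar i) ^+ 2 / (2 * L)))%:E)%E.
  move=> Fz.
  have -> : z i.+1 = (1 - eta) *: z i + (1 - (1 - eta)) *: zbar i.
    by rewrite zS addrC subKr.
  have t01 : 0 < 1 - eta < 1 by rewrite subr_gt0 eta1 ltrBlDr ltrDl eta0.
  exact: (rconj_strongly_convex nrmP f_diff f_smooth _ _ _ _ _ L0 Fz (Fzbar i) t01).
have Fz i : fstar (z i) = (F (z i))%:E.
  elim: i => [|i IH]; first exact: F_fin.
  by apply: F_fin; rewrite (le_lt_trans (fs_step i IH))// ltry.
pose P i := hstar (- z i) + F (z i).
pose g i := grad hstar (- z i).
(* The Wolfe gap: [P i - S i] is the value of [Gamma i] at [zbar i], its minimizer. *)
pose S i := F (z i) - F (zbar i) - dotp (g i) (z i - zbar i).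
have psiE i : psi (z i) = (P i)%:E by rewrite /psi hs_fin Fz.
have Gamma_ge i v : ((P i - S i)%:E <= Gamma i v)%E.
  have := zbarP i v; rewrite /Gamma hs_fin Fzbar.
  case: (fstar v) (fs_gt v) => [r| |]// _; last by rewrite !addey// !leey.
  rewrite -!EFinD !lee_fin /P /S -/(g i) !dotpNl !dotpBr; lra.
have psi_ge i v : ((P i - S i)%:E <= psi v)%E.
  apply: le_trans (Gamma_ge i v) _; rewrite /psi /Gamma !hs_fin.
  (* The model lies below [psi] because the tangent to [hstar] lies below [hstar]. *)
  rewrite leeD2r// -EFinD lee_fin.
  have /andP[+ _] := hs_bounds (- z i) (- v); rewrite opprK.
  by rewrite -/(g i) dotpNl !dotpBr dotpDr dotpNr; lra.
(* A finite [D0] together with a finite [psi (z 0)] forces the infimum to be real. *)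
have [m infE] : exists m, ereal_inf (range psi) = m%:E.
  move: D0E; rewrite psiE; case: (ereal_inf _) => // r _; by exists r.
have m_le v : (m%:E <= psi v)%E by rewrite -infE; apply: ereal_inf_lbound; exists v.
have m_ge i : P i - S i <= m.
  by rewrite -lee_fin -infE; apply: le_ereal_inf_tmp => _ [v _ <-]; exact: psi_ge.
have D0P : P 0%N - m = D0 by move: D0E; rewrite psiE infE -EFinB => -[].
have dS i : 0 <= P i - m <= S i.
  have := m_le (z i); rewrite psiE lee_fin; have := m_ge i.
  by move=> ? ?; apply/andP; split; lra.
(* The linear terms sum to [- eta * S i]. The quadratic ones are [eta ^+ 2 / (2 alpha)] and
   [- eta (1 - eta) / (2 L)] times [N ^+ 2], and [eta / alpha = (1 - eta) / L]. *)
have step i : P i.+1 - m <= P i - m - eta * S i.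
  have := fs_step i (Fz i); rewrite Fz lee_fin.
  have /andP[_] := hs_bounds (- z i) (- z i.+1).
  have -> : - z i.+1 - - z i = eta *: (z i - zbar i).
    by rewrite zS opprK scalerBr scalerBl scale1r opprD opprB addrA subrK addrC.
  rewrite dotpZr -/(g i).
  set d := z i - zbar i; set N := dual_norm nrm d.
  have : dual_norm nrm (eta *: d) ^+ 2 / (2 * alpha) <= eta ^+ 2 * N ^+ 2 / (2 * alpha).
    have a2V : 0 < (2 * alpha)^-1 by rewrite invr_gt0 mulr_gt0.
    rewrite (ler_pM2r a2V) -exprMn.
    have N0 : 0 <= eta * N by rewrite mulr_ge0 ?(ltW eta0)// dual_norm_ge0.
    have eN0 : 0 <= dual_norm nrm (eta *: d) by exact: dual_norm_ge0.
    by rewrite lerXn2r// (dual_normZ_le nrmP _ _ (ltW eta0)).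
  (* The step size is chosen so that both quadratic terms cancel. *)
  have -> : eta ^+ 2 * N ^+ 2 / (2 * alpha) =
      (1 - eta) * (1 - (1 - eta)) * (N ^+ 2 / (2 * L)).
    by rewrite /eta; field; rewrite !gt_eqF.
  rewrite /P /S -/d; lra.
have eta01 : 0 < eta <= 1 by rewrite eta0 ltW.
have Sk : S k <= eps / 2.
  apply: (le_trans (gap_geometric_decay _ (fun i => P i - m) S eta01 dS step k)).
  have /andP[D0_ge0 _] := dS 0%N.
  rewrite D0P; apply: iteration_bound => //.
  by rewrite -D0P.
have inf_ge : ((P k - S k)%:E <= ereal_inf (range (Gamma k)))%E.
  by apply: le_ereal_inf_tmp => _ [v _ <-]; exact: Gamma_ge.
rewrite psiE; apply: le_trans (leeB (lexx _) inf_ge) _.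
by rewrite -EFinB lee_fin; lra.
Qed.
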